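(* Let $X\subseteq\mathbb{P}^n$ be a reduced non-degenerate scheme which is set-theoretically defined by quadrics. If $W\subseteq\mathbb{P}^n$ is a projective linear subspace of dimension $p$ such that $\Gamma:=W\cap X$ is zero-dimensional and contains $p+2$ real reduced points, then $\eta(X)\leq p$.
   Context: $S=\mathbb{R}[x_0,\dots,x_n]$, $R=S/I(X)$. $\Sigma_X\subseteq R_2$ is the cone of sums of squares of elements of $R_1$; its dual $\Sigma_X^*$ is regarded inside $S_2^*$. For $\ell\in S_2^*$, the rank of $\ell$ is the rank of the bilinear form $(f,g)\mapsto\ell(fg)$ on $S_1$. The Hankel index $\eta(X)$ is the smallest integer $p>1$ such that $\Sigma_X^*$ has an extreme ray of rank $p$ ($\infty$ if all extreme rays have rank $1$). $X$ is set-theoretically defined by quadrics if $X=\mathbb{V}(I(X)_2)$ as sets. *)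

(* Defs.v *)
From HB Require Import structures.
From mathcomp Require Import all_boot all_order all_algebra.
From mathcomp Require Import reals.
From mathcomp Require Import mpoly.
From mathcomp Require Import complex.

Set Implicit Arguments.
Unset Strict Implicit.
Unset Printing Implicit Defensive.

Import GRing.Theory Num.Theory.
Local Open Scope ring_scope.

Section Defs.
Context {R : realType} {n : nat}.
Local Notation S := {mpoly R[n.+1]}.

Definition is_homog_ideal (I : pred S) : Prop :=
  [/\ 0 \in I,
      {in I &, forall f g, f + g \in I},
      (forall h f, f \in I -> h * f \in I)
    & (forall d f, f \in I -> pihomog mdeg d f \in I)].

Definition is_radical (I : pred S) : Prop :=
  forall f k, f ^+ k.+1 \in I -> f \in I.

Definition is_saturated (I : pred S) : Prop :=
  forall f, (exists k, forall i : 'I_n.+1, 'X_i ^+ k * f \in I) -> f \in I.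

Definition evalC (f : S) (z : 'I_n.+1 -> R[i]) : R[i] :=
  mmap (real_complex R) z f.

Definition nonzeroC (z : 'I_n.+1 -> R[i]) : Prop := exists i, z i != 0.
Definition nonzeroR (q : 'I_n.+1 -> R) : Prop := exists i, q i != 0.

Definition nondegenerate_var (I : pred S) : Prop :=
  forall f, f \in I -> f \is 1.-homog -> f = 0.

Definition settheor_quadrics (I : pred S) : Prop :=
  forall z, nonzeroC z ->
    (forall f, f \in I -> f \is 2.-homog -> evalC f z = 0) ->
    (forall f, f \in I -> evalC f z = 0).

Definition vanishing_linear_form (p : nat) (A : 'M[R]_(p.+1, n.+1)) (l : S) :=
  l \is 1.-homog /\ forall i : 'I_p.+1, l.@[fun j => A i j] = 0.

(* ideal I(X) + I(W) of the scheme Gamma = W \cap X *)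
Definition sum_ideal (I : pred S) (p : nat) (A : 'M[R]_(p.+1, n.+1)) (f : S) : Prop :=
  exists g, g \in I /\ exists s : seq (S * S),
    (forall x, x \in s -> vanishing_linear_form A x.2) /\
    f = g + \sum_(x <- s) x.1 * x.2.

(* the projective scheme V(J) is zero-dimensional: finitely many complex points
   (and at least one, which will follow from the other hypotheses) *)
Definition zero_dimensional (J : S -> Prop) : Prop :=
  (exists z, nonzeroC z /\ forall f, J f -> evalC f z = 0) /\
  exists (m : nat) (w : 'I_m -> 'I_n.+1 -> R[i]),
    forall z, nonzeroC z -> (forall f, J f -> evalC f z = 0) ->
      exists k c, forall j, z j = c * w k j.

Definition real_point_of (J : S -> Prop) (q : 'I_n.+1 -> R) : Prop :=
  nonzeroR q /\ forall f, J f -> f.@[q] = 0.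

Definition homogeneous (f : S) : Prop := exists d, f \is d.-homog.

(* the local ring of Proj(S/J) at the real point q (degree-0 part of the
   homogeneous localization at the homogeneous prime P_q) is reduced:
   (f/g)^k = 0 implies f/g = 0 *)
Definition reduced_at (J : S -> Prop) (q : 'I_n.+1 -> R) : Prop :=
  forall (f h : S) (k : nat), homogeneous f -> homogeneous h ->
    h.@[q] != 0 -> J (h * f ^+ k) ->
    exists h' : S, [/\ homogeneous h', h'.@[q] != 0 & J (h' * f)].

Definition proportionalR (q q' : 'I_n.+1 -> R) : Prop :=
  exists c, forall j, q j = c * q' j.

(* elements of S_2^*, viewed as linear functionals on S that only see
   the degree-2 homogeneous component *)
Definition in_S2dual (l : S -> R) : Prop :=
  (forall a f g, l (a *: f + g) = a * l f + l g) /\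
  (forall f, l f = l (pihomog mdeg 2 f)).

Definition in_SigmaX_dual (I : pred S) (l : S -> R) : Prop :=
  [/\ in_S2dual l,
      (forall f, f \in I -> f \is 2.-homog -> l f = 0)
    & (forall s : seq S, (forall g, g \in s -> g \is 1.-homog) ->
         0 <= l (\sum_(g <- s) g ^+ 2))].

Definition extreme_ray (I : pred S) (l : S -> R) : Prop :=
  [/\ in_SigmaX_dual I l,
      (exists f, l f != 0)
    & (forall l1 l2, in_SigmaX_dual I l1 -> in_SigmaX_dual I l2 ->
         (forall f, l f = l1 f + l2 f) ->
         exists2 c, 0 <= c & forall f, l1 f = c * l f)].

(* rank of the bilinear form (f,g) |-> l(fg) on S_1 (Gram matrix in the basis x_0..x_n) *)
Definition form_rank (l : S -> R) : nat :=
  \rank (\matrix_(i < n.+1, j < n.+1) l ('X_i * 'X_j)).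

(* eta(X) <= p, where eta(X) = min { r > 1 | Sigma_X^* has an extreme ray of rank r }
   (eta = +oo if no such r) *)
Definition hankel_index_le (I : pred S) (p : nat) : Prop :=
  exists l, extreme_ray I l /\ (1 < form_rank l <= p)%N.

End Defs.

(* Main.v *)
Require Import Defs.
From HB Require Import structures.
From mathcomp Require Import all_boot all_order all_algebra.
From mathcomp Require Import boolp classical_sets reals.
From mathcomp Require Import mpoly.
From mathcomp Require Import complex.
From mathcomp Require Import ring lra.
Import Order.TTheory GRing.Theory Num.Theory.
Local Open Scope ring_scope.

(** p+2 points of W are linearly dependent, so one of them is a combination
    [u Q] of linearly independent others (the rows of [Q]) with all [u_i] nonzero.
    For [t > 0] and the critical [b], the functional
    [l f = sum_i t^-i f(Q_i) - b f(u Q)] is positive semidefinite on squares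
    (Cauchy-Schwarz) and its form is supported on [span Q], with the extra kernel
    element the linear form [h] with [h(Q_i) = u_i t^i]. As t varies [h] follows a
    moment curve, so some t makes [h] nonzero at each of the finitely many real
    points of Gamma. Subtracting maximal multiples of summands of [l] lowers the
    rank until an extreme ray [l'] is reached, whose kernel contains that of [l].
    If [l'] had rank 1 it would be evaluation at a real point z which lies on W,
    is killed by the quadrics of I, hence lies in Gamma, and satisfies [h(z) = 0]:
    a contradiction. *)

(** * Positive semidefinite matrices and the lowering of their rank *)

Definition bil {F : pzRingType} {d : nat} (N : 'M[F]_d) (x y : 'rV[F]_d) : F :=
  (x *m N *m y^T) 0 0.

Definition psd {F : numDomainType} {d : nat} (N : 'M[F]_d) : Prop :=
  N^T = N /\ forall x, 0 <= bil N x x.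

Lemma bilE (F : pzRingType) (d : nat) (N : 'M[F]_d) (x y : 'rV[F]_d) :
  bil N x y = \sum_i \sum_j x 0 i * N i j * y 0 j.
Proof.
rewrite /bil mxE exchange_big; apply: eq_bigr => j _ /=.
by rewrite !mxE mulr_suml.
Qed.

Lemma bil_sym (F : comPzRingType) (d : nat) (N : 'M[F]_d) (x y : 'rV[F]_d) :
  N^T = N -> bil N x y = bil N y x.
Proof.
move=> NT; rewrite !bilE exchange_big; apply: eq_bigr => j _ /=.
by apply: eq_bigr => i _; rewrite -{1}NT mxE; ring.
Qed.

Lemma bil_line (F : comPzRingType) (d : nat) (N : 'M[F]_d) (x y : 'rV[F]_d) s :
  N^T = N -> bil N (x + s *: y) (x + s *: y) =
    bil N x x + s * (bil N x y *+ 2) + s ^+ 2 * bil N y y.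
Proof.
move=> NT; have := bil_sym _ _ N y x NT.
rewrite /bil linearD linearZ /= !mulmxDl !mulmxDr -!scalemxAl -!scalemxAr !mxE.
move=> ->; ring.
Qed.

(** The polynomial in [s] from [bil_line] is nonnegative; for [c > 0] its value at the minimiser
    [- b / c] gives the inequality. *)
Lemma psd_cauchy (F : realFieldType) (d : nat) (N : 'M[F]_d) (x y : 'rV[F]_d) :
  psd N -> bil N x y ^+ 2 <= bil N x x * bil N y y.
Proof.
move=> [NT N0].
have P s : 0 <= bil N x x + s * (bil N x y *+ 2) + s ^+ 2 * bil N y y.
  by rewrite -bil_line.
move: (N0 x) (N0 y) P.
set a := bil N x x; set b := bil N x y; set c := bil N y y => a0 c0 P.
have [c_eq0|c_neq0] := eqVneq c 0.
  rewrite c_eq0 mulr0; have [->|b_neq0] := eqVneq b 0; first by rewrite expr0n.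
  (* For [c = 0] the polynomial is affine in [s], and this [s] would give it the value -1. *)
  have := P (- (a + 1) / (b *+ 2)).
  rewrite c_eq0 mulr0 addr0 mulfVK ?mulrn_eq0 //; lra.
have c_gt0 : 0 < c by rewrite lt_def c_neq0.
have := P (- b / c); rewrite -(pmulr_rge0 _ c_gt0).
suff -> : c * (a + - b / c * (b *+ 2) + (- b / c) ^+ 2 * c) = a * c - b ^+ 2.
  by rewrite subr_ge0.
by field.
Qed.

(** Cauchy-Schwarz against the basis vectors bounds the square of each coordinate of [x *m N] by
    0. *)
Lemma psd_isotropic (F : realFieldType) (d : nat) (N : 'M[F]_d) (x : 'rV[F]_d) :
  psd N -> bil N x x = 0 -> x *m N = 0.
Proof.
move=> N0 xN; apply/rowP => j.
have := psd_cauchy _ _ _ x (delta_mx 0 j) N0.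
rewrite xN mul0r exprn_even_le0 //= => /eqP.
by rewrite /bil trmx_delta -colE !mxE.
Qed.

Lemma rowsqE (F : pzRingType) (d : nat) (x : 'rV[F]_d) :
  (x *m x^T) 0 0 = \sum_i x 0 i ^+ 2.
Proof. by rewrite mxE; apply: eq_bigr => i _; rewrite mxE expr2. Qed.

Lemma bil_bound (F : realFieldType) (d : nat) (N : 'M[F]_d) :
  exists2 K, 0 <= K & forall x, bil N x x <= K * (x *m x^T) 0 0.
Proof.
exists (\sum_i \sum_j `|N i j|).
  by do 2![apply: sumr_ge0 => ? _].
move=> x; rewrite bilE mulr_suml; apply: ler_sum => i _.
rewrite mulr_suml; apply: ler_sum => j _.
have le_sq k : x 0 k ^+ 2 <= (x *m x^T) 0 0.
  by rewrite rowsqE (bigD1 k) //= lerDl sumr_ge0 // => l _; rewrite sqr_ge0.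
rewrite mulrAC mulrC; apply: le_trans (ler_norm _) _.
rewrite normrM ler_wpM2l // ler_norml; have := le_sq i; have := le_sq j.
have := sqr_ge0 (x 0 i + x 0 j); have := sqr_ge0 (x 0 i - x 0 j).
nra.
Qed.

(* Cauchy-Schwarz for [N] at the pair [x], [x *m N]. *)
Lemma psd_mul_bound (F : realFieldType) (d : nat) (N : 'M[F]_d) :
  psd N -> exists2 K, 0 <= K &
    forall x, ((x *m N) *m (x *m N)^T) 0 0 <= K * bil N x x.
Proof.
move=> N0; have [K K0 KP] := bil_bound _ _ N; exists K => // x.
set y := x *m N; have := psd_cauchy _ _ _ x y N0; have := KP y.
rewrite {2}/bil -/y; set s := (y *m y^T) 0 0.
have s0 : 0 <= s.
  by rewrite /s rowsqE sumr_ge0 // => i _; rewrite sqr_ge0.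
have b0 : 0 <= bil N x x by apply: (proj2 N0).
have [->|s_neq0] := eqVneq s 0; first by rewrite mulr_ge0.
have s_gt0 : 0 < s by rewrite lt_def s_neq0.
move=> h1 h2; rewrite -(ler_pM2r s_gt0) -expr2.
by apply: le_trans h2 _; rewrite [K * _]mulrC -mulrA ler_wpM2l.
Qed.

Lemma bil_subZ (F : comPzRingType) (d : nat) (N M : 'M[F]_d) t (x : 'rV[F]_d) :
  bil (N - t *: M) x x = bil N x x - t * bil M x x.
Proof. by rewrite /bil mulmxBr mulmxBl -scalemxAr -scalemxAl !mxE. Qed.

Lemma trmx_subZ (F : pzRingType) (d : nat) (N M : 'M[F]_d) t :
  N^T = N -> M^T = M -> (N - t *: M)^T = N - t *: M.
Proof. by move=> NT MT; rewrite linearB linearZ /= NT MT. Qed.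

(** Symmetry and the inclusion of row spaces give [M = N C N], so the form of [M] at [x] is that of
    [C] at [x *m N]. This is bounded by a multiple of the squared length of [x *m N], hence of
    [bil N x x]. *)
Lemma psd_perturb (F : realFieldType) (d : nat) (N M : 'M[F]_d) :
  psd N -> M^T = M -> (M <= N)%MS -> exists2 e, 0 < e & psd (N - e *: M).
Proof.
move=> N0 MT MN; have [NT Nge0] := N0.
have [P E] : exists P, M *m P *m N = M by exists (pinvmx N); apply: mulmxKpV.
have E' := congr1 trmx E; rewrite !trmx_mul NT MT in E'.
pose C := P^T *m M *m P.
have ME : M = N *m C *m N by rewrite /C !mulmxA -(mulmxA N) E' E.
have [K K0 KP] := bil_bound _ _ C; have [K' K'0 K'P] := psd_mul_bound _ _ _ N0.
have KK : 0 < K * K' + 1 by rewrite ltr_wpDl // mulr_ge0.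
(* The added 1 covers the case [K * K' = 0]. *)
exists (K * K' + 1)^-1; first by rewrite invr_gt0.
split; first exact: trmx_subZ.
move=> x; rewrite bil_subZ subr_ge0 ler_pdivrMl //.
have -> : bil M x x = bil C (x *m N) (x *m N).
  by rewrite /bil ME trmx_mul NT !mulmxA.
apply: le_trans (KP _) _; rewrite mulrDl mul1r -mulrA.
by apply: le_trans (ler_wpM2l K0 (K'P x)) _; rewrite lerDl Nge0.
Qed.

(** Since [M] lies between 0 and [N] as a form, vectors killed by [N] are isotropic for [M], hence
    killed by it. For symmetric matrices this reverses to an inclusion of row spaces. *)
Lemma psd_submx (F : realFieldType) (d : nat) (N M : 'M[F]_d) :
  psd N -> psd M -> psd (N - M) -> (M <= N)%MS.
Proof.
move=> [NT N0] M0 [_ NM0]; have [MT Mge0] := M0.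
rewrite submxE -[M]MT -[cokermx N]trmxK -trmx_mul.
suff -> : (cokermx N)^T *m M = 0 by rewrite trmx0.
apply/row_matrixP => i; rewrite row_mul row0; set x := row i _.
have xN : x *m N = 0.
  by rewrite -row_mul -[N in _ *m N]NT -trmx_mul mulmx_coker trmx0 row0.
apply: psd_isotropic => //; apply/eqP; rewrite eq_le Mge0 andbT.
have := NM0 x; rewrite -[X in N - X]scale1r bil_subZ mul1r.
by rewrite {1}/bil xN mul0mx mxE sub0r oppr_ge0.
Qed.

(** Take the largest [t] that keeps the difference semidefinite. If the rank did not drop, the row
    space of [M] would lie in that of [N - t *: M], and [psd_perturb] would allow a larger [t]. *)
Lemma psd_drop_rank (R : realType) (d : nat) (N M : 'M[R]_d) :
  psd N -> psd M -> psd (N - M) -> M != 0 ->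
  exists t, [/\ 0 < t, psd (N - t *: M), (N - t *: M <= N)%MS &
                (\rank (N - t *: M)%R < \rank N)%N].
Proof.
move=> N0 M0 NM0 M_neq0; have MN := psd_submx _ _ _ _ N0 M0 NM0.
have [[NT Nge0] [MT Mge0]] := (N0, M0).
have [x xM] : exists x, 0 < bil M x x.
  have /rowV0Pn[_ /submxP[y ->] yM] : M != 0 by [].
  exists y; rewrite lt_def Mge0 andbT; apply: contraNneq yM => E.
  by rewrite (psd_isotropic _ _ _ _ M0 E).
pose T : R -> Prop := fun t => psd (N - t *: M).
have T1 : T 1 by rewrite /T /= scale1r.
have supT : has_sup T.
  split; first by exists 1.
  exists (bil N x x / bil M x x) => t [_ /(_ x)].
  by rewrite bil_subZ subr_ge0 ler_pdivlMr.
pose t := sup T.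
have t1 : 1 <= t by apply: ub_le_sup => //; case: supT.
have t0 : 0 < t by apply: lt_le_trans t1.
(* The supremum is attained: each [y] imposes only a non-strict upper bound on [t]. *)
have Tt : psd (N - t *: M).
  split; first exact: trmx_subZ.
  move=> y; rewrite bil_subZ subr_ge0; have := Mge0 y.
  rewrite le_eqVlt => /predU1P[<-|yM]; first by rewrite mulr0.
  rewrite -ler_pdivlMr //; apply: ge_sup; first by exists 1.
  by move=> s [_ /(_ y)]; rewrite bil_subZ subr_ge0 ler_pdivlMr.
have le : (N - t *: M <= N)%MS.
  by rewrite addmx_sub // -scaleNr scalemx_sub.
exists t; split => //; rewrite ltn_neqAle mxrankS // andbT.
apply/negP => /eqP rk.
have MN' : (M <= N - t *: M)%MS.
  apply: submx_trans MN _.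
  by have := mxrank_leqif_sup le; rewrite rk => /leqif_refl.
have [e e0] := psd_perturb _ _ _ _ Tt MT MN'.
rewrite -addrA -opprD -scalerDl => Te.
have : t + e <= t by apply: ub_le_sup => //; case: supT.
by rewrite gerDl leNgt e0.
Qed.

(** The form of [N] at [x] is [bil D x x - bil D x h ^+ 2 / bil D h h], nonnegative by
    Cauchy-Schwarz, and the matrix subtracted from [D] has rank at most 1. *)
Lemma psd_deflate (F : realFieldType) (d : nat) (D : 'M[F]_d) (h : 'rV[F]_d) :
  psd D -> 0 < bil D h h ->
  let N := D - (bil D h h)^-1 *: ((h *m D)^T *m (h *m D)) in
  [/\ psd N, h *m N = 0 & (\rank D <= (\rank N).+1)%N].
Proof.
move=> D0 hh N; have [DT Dge0] := D0.
have DhT : (h *m D)^T = D *m h^T by rewrite trmx_mul DT.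
split.
- split; first by apply: trmx_subZ; rewrite // trmx_mul trmxK.
  move=> x; rewrite bil_subZ subr_ge0 ler_pdivrMl // [leRHS]mulrC.
  apply: le_trans (psd_cauchy _ _ _ x h D0); rewrite le_eqVlt; apply/orP; left.
  rewrite /bil DhT !mulmxA -!(mulmxA (x *m D *m h^T)) [X in X == _]mxE big_ord1.
  by rewrite -!/(bil D _ _) (bil_sym _ _ _ h) // expr2.
- rewrite /N mulmxBr -scalemxAr DhT !mulmxA.
  rewrite [h *m D *m h^T]mx11_scalar -!mulmxA mul_scalar_mx scalerA -/(bil D h h).
  by rewrite mulmxA -/(bil D h h) mulVf ?gt_eqF // scale1r subrr.
- have -> : D = N + (bil D h h)^-1 *: ((h *m D)^T *m (h *m D)) by rewrite subrK.
  apply: leq_trans (mxrank_add _ _) _; rewrite -[leqRHS]addn1 leq_add2l.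
  apply: leq_trans (mxrank_scale _ _) _.
  by apply: leq_trans (mxrankM_maxr _ _) _; apply: rank_leq_row.
Qed.

(** * Minimal linear dependencies and the moment curve *)

(** Rows are dropped as long as some representation of [v *m Q] has a zero coordinate. Once none
    has, the remaining rows are independent. *)
Lemma support_circuit (F : fieldType) (m d : nat) (Q : 'M[F]_(m, d)) (v : 'rV[F]_m) :
  exists k (f : 'I_k -> 'I_m) (u : 'rV[F]_k),
    [/\ (k <= m)%N, u *m rowsub f Q = v *m Q, row_free (rowsub f Q)
      & forall i, u 0 i != 0].
Proof.
elim: m Q v => [|m IH] Q v.
  exists 0, id, v; split => //; last by case.
    by rewrite mxsub_id.
  by rewrite /row_free flatmx0 mxrank0.
have [[v' [i [<- v'i]]]|noz] :=
  pselect (exists v' i, v' *m Q = v *m Q /\ v' 0 i = 0).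
  have [k [f [u [km uE fr u0]]]] := IH (row' i Q) (col' i v').
  exists k, (lift i \o f), u.
  have E : rowsub (lift i \o f) Q = rowsub f (row' i Q).
    by apply/matrixP => a b; rewrite !mxE.
  split => //; rewrite ?E ?(leqW km) // uE.
  apply/rowP => j; rewrite !mxE (bigD1_ord i) //= v'i mul0r add0r.
  by apply: eq_bigr => a _; rewrite !mxE.
exists m.+1, id, v; rewrite mxsub_id; split => //; last first.
  by move=> i; apply/eqP => vi; apply: noz; exists v, i.
rewrite -kermx_eq0; apply/rowV0P => u /sub_kermxP uQ.
apply/eqP; apply/negPn/negP => /rV0Pn[i ui]; apply: noz.
(* A relation [u] with [u_i] nonzero would cancel coordinate [i] without changing [v *m Q]. *)
exists (v - (v 0 i / u 0 i) *: u), i; split.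
  by rewrite mulmxBl -scalemxAl uQ scaler0 subr0.
by rewrite !mxE divfK // subrr.
Qed.

(** Each condition excludes the roots of a nonzero polynomial in [t], so a positive non-root of
    their product suffices. *)
Lemma moment_curve_avoids (F : realFieldType) (m k : nat) (w : 'I_m -> 'rV[F]_k) :
  (forall j, w j != 0) -> exists2 t, 0 < t & forall j, \sum_i w j 0 i * t ^+ i != 0.
Proof.
move=> w0; pose P j := \sum_i (w j 0 i)%:P * 'X^i.
have Pt j t : (P j).[t] = \sum_i w j 0 i * t ^+ i.
  by rewrite horner_sum; apply: eq_bigr => i _; rewrite !hornerE.
have P0 : \prod_j P j != 0.
  apply/prodf_neq0 => j _; have /rV0Pn[i wi] := w0 j.
  apply: contraNneq wi => /(congr1 (fun p : {poly F} => p`_i)).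
  rewrite coef0 coef_sum (bigD1 i) //= coefCM coefXn eqxx mulr1 big1 ?addr0 => [->//|].
  by move=> l li; rewrite coefCM coefXn eq_sym val_eqE (negPf li) mulr0.
have [t t0 nr] : exists2 t : F, 0 < t & ~~ root (\prod_j P j) t.
  (* As many distinct positive candidates as the size of the product, one more than its degree. *)
  pose rs := [seq l.+1%:R : F | l <- iota 0 (size (\prod_j P j))].
  apply: contrapT => H.
  have rs_root : all (root (\prod_j P j)) rs.
    apply/allP => _ /mapP[l _ ->].
    by apply/negPn/negP => nr; apply: H; exists l.+1%:R.
  have := max_poly_roots P0 rs_root.
  rewrite size_map size_iota ltnn map_inj_uniq ?iota_uniq; first by move=> /(_ isT).
  by move=> x y /eqP; rewrite eqr_nat => /eqP[].
exists t => // j; rewrite -Pt.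
by move: nr; rewrite rootE horner_prod => /prodf_neq0; apply.
Qed.

(** * Quadratic functionals and their Gram matrices *)

(** The matrix inside [form_rank], so that [form_rank l] unfolds to [\rank (gram l)]. *)
Definition gram {R : realType} {n : nat} (l : {mpoly R[n.+1]} -> R) : 'M[R]_n.+1 :=
  \matrix_(i, j) l ('X_i * 'X_j).

Definition linform {R : realType} {n : nat} (x : 'rV[R]_n.+1) : {mpoly R[n.+1]} :=
  \sum_i x 0 i *: 'X_i.

Lemma linform_homog (R : realType) (n : nat) (x : 'rV[R]_n.+1) : linform x \is 1.-homog.
Proof. by apply: rpred_sum => i _; rewrite rpredZ // dhomogX /= mdeg1. Qed.

Lemma linform_eval (R : realType) (n : nat) (x : 'rV[R]_n.+1) (z : 'I_n.+1 -> R) :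
  (linform x).@[z] = \sum_i x 0 i * z i.
Proof.
by rewrite raddf_sum; apply: eq_bigr => i _; rewrite /= mevalZ mevalXU.
Qed.

Lemma homog1_linform (R : realType) (n : nat) (g : {mpoly R[n.+1]}) :
  g \is 1.-homog -> exists x, g = linform x.
Proof.
move=> g1; exists (\row_i g@_(U_(i))%MM); apply/mpolyP => m.
rewrite raddf_sum /=.
have [/eqP/mdeg1P[k /eqP ->]|m1] := eqVneq (mdeg m) 1%N.
  rewrite (bigD1 k) //= big1 ?addr0 => [|i ik]; rewrite mcoeffZ mcoeffX.
    by rewrite mxE eqxx mulr1.
  by rewrite eq_mnm1 (negPf ik) mulr0.
rewrite (dhomog_nemf_coeff g1) // big1 // => i _.
rewrite mcoeffZ mcoeffX; case: eqP => [mE|_]; last by rewrite mulr0.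
by rewrite -mE mdeg1 in m1.
Qed.

Lemma S2dual0 (R : realType) (n : nat) (l : {mpoly R[n.+1]} -> R) :
  in_S2dual l -> l 0 = 0.
Proof.
by move=> [lin _]; have := lin (-1) 0 0; rewrite scaler0 add0r mulN1r addNr.
Qed.

Lemma S2dualD (R : realType) (n : nat) (l : {mpoly R[n.+1]} -> R) f g :
  in_S2dual l -> l (f + g) = l f + l g.
Proof. by move=> [lin _]; rewrite -[f]scale1r lin mul1r scale1r. Qed.

Lemma S2dualZ (R : realType) (n : nat) (l : {mpoly R[n.+1]} -> R) a f :
  in_S2dual l -> l (a *: f) = a * l f.
Proof.
by move=> ldual; have [lin _] := ldual; rewrite -[_ *: _]addr0 lin S2dual0 ?addr0.
Qed.

Lemma S2dual_sum (R : realType) (n : nat) (l : {mpoly R[n.+1]} -> R)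
    (T : Type) (s : seq T) (F : T -> {mpoly R[n.+1]}) :
  in_S2dual l -> l (\sum_(i <- s) F i) = \sum_(i <- s) l (F i).
Proof.
move=> ldual; elim: s => [|i s IH]; first by rewrite !big_nil S2dual0.
by rewrite !big_cons S2dualD // IH.
Qed.

Lemma gram_sym (R : realType) (n : nat) (l : {mpoly R[n.+1]} -> R) :
  (gram l)^T = gram l.
Proof. by apply/matrixP => i j; rewrite !mxE mulrC. Qed.

Lemma S2dual_bil (R : realType) (n : nat) (l : {mpoly R[n.+1]} -> R) x y :
  in_S2dual l -> l (linform x * linform y) = bil (gram l) x y.
Proof.
move=> ldual; rewrite bilE mulr_suml S2dual_sum //; apply: eq_bigr => i _.
rewrite mulr_sumr S2dual_sum //; apply: eq_bigr => j _.
by rewrite -scalerAl -scalerAr !S2dualZ // mxE; ring.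
Qed.

Lemma mdeg2P (n : nat) (m : 'X_{1..n}) :
  mdeg m = 2 -> exists i j, m = (U_(i) + U_(j))%MM.
Proof.
move=> m2; have [i mi] : exists i, m i != 0%N.
  apply: contrapT => H; have : m == 0%MM.
    apply/eqP/mnmP => i; rewrite mnm0E; apply/eqP/negPn/negP => mi.
    by apply: H; exists i.
  by rewrite -mdeg_eq0 m2.
have le : (U_(i) <= m)%MM by rewrite lep1mP.
have : mdeg (m - U_(i))%MM == 1%N.
  by have := mdegD (m - U_(i))%MM U_(i)%MM; rewrite submK // m2 mdeg1 addn1 => -[<-].
by move/mdeg1P => [j /eqP E]; exists j, i; rewrite -E submK.
Qed.

(** A monomial of degree 2 is a product of two variables, and [l] ignores all other degrees. *)
Lemma S2dual_eq0 (R : realType) (n : nat) (l : {mpoly R[n.+1]} -> R) :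
  in_S2dual l -> gram l = 0 -> forall f, l f = 0.
Proof.
move=> ldual G0 f; rewrite [f]mpolyE S2dual_sum // big1 // => m _.
rewrite S2dualZ // (proj2 ldual) pihomogX.
case: eqP => [m2|_]; last by rewrite S2dual0 // mulr0.
have [i [j ->]] := mdeg2P _ _ m2.
by have := congr1 (fun N : 'M_n.+1 => N i j) G0; rewrite !mxE mpolyXD => ->; rewrite mulr0.
Qed.

Lemma S2dual_subZ (R : realType) (n : nat) (l l' : {mpoly R[n.+1]} -> R) t :
  in_S2dual l -> in_S2dual l' -> in_S2dual (fun f => l f - t * l' f).
Proof.
move=> [lin h] [lin' h']; split=> [a f g|f]; last by rewrite h h'.
by rewrite lin lin'; ring.
Qed.

Lemma gram_subZ (R : realType) (n : nat) (l l' : {mpoly R[n.+1]} -> R) t :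
  gram (fun f => l f - t * l' f) = gram l - t *: gram l'.
Proof. by apply/matrixP => i j; rewrite !mxE. Qed.

(** Linear forms are the [linform x], so nonnegativity on sums of squares is semidefiniteness of the
    Gram matrix; the cone can then be handled by matrices. *)
Lemma SigmaX_dualP (R : realType) (n : nat) (I : pred {mpoly R[n.+1]}) l :
  in_SigmaX_dual I l <->
    [/\ in_S2dual l, forall f, f \in I -> f \is 2.-homog -> l f = 0 & psd (gram l)].
Proof.
split=> -[ldual lI l0]; split=> //.
  split=> [|x]; first exact: gram_sym.
  rewrite -S2dual_bil //; have := l0 [:: linform x].
  rewrite big_seq1 expr2; apply => g; rewrite inE => /eqP ->.
  exact: linform_homog.
move=> s s1; rewrite S2dual_sum // big_seq; apply: sumr_ge0 => g /s1.
by move=> /homog1_linform[x ->]; rewrite expr2 S2dual_bil //; apply: (proj2 l0).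
Qed.

Lemma gram_neq0 (R : realType) (n : nat) (l : {mpoly R[n.+1]} -> R) :
  in_S2dual l -> (exists f, l f != 0) -> gram l != 0.
Proof.
by move=> ldual [f]; apply: contraNneq => G0; rewrite S2dual_eq0.
Qed.

(** * Extreme rays and functionals of rank one *)

(** Induction on the rank: a decomposition [l1 + l2] that refutes extremality feeds [psd_drop_rank],
    whose row-space inclusion is carried along. *)
Lemma exists_extreme_ray (R : realType) (n : nat) (I : pred {mpoly R[n.+1]}) l :
  in_SigmaX_dual I l -> (exists f, l f != 0) ->
  exists l', extreme_ray I l' /\ (gram l' <= gram l)%MS.
Proof.
have [r] := ubnP (\rank (gram l)); elim: r l => // r IH l rk lS l0.
have [ext|next] := pselect (extreme_ray I l); first by exists l; rewrite submx_refl.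
have [l1 [l2 [l1S l2S lE l1_nmul]]] : exists l1 l2,
    [/\ in_SigmaX_dual I l1, in_SigmaX_dual I l2, forall f, l f = l1 f + l2 f
      & ~ exists2 c, 0 <= c & forall f, l1 f = c * l f].
  apply: contrapT => H; apply: next; split=> // l1 l2 l1S l2S lE.
  by apply: contrapT => H'; apply: H; exists l1, l2.
have /SigmaX_dualP[ldual lI G0] := lS.
have /SigmaX_dualP[l1dual l1I G1] := l1S.
have /SigmaX_dualP[l2dual _ G2] := l2S.
have G1_neq0 : gram l1 != 0.
  apply/eqP => E; apply: l1_nmul; exists 0 => // f.
  by rewrite S2dual_eq0 // mul0r.
have GE : gram l - gram l1 = gram l2.
  by apply/matrixP => i j; rewrite !mxE lE addrC addKr.
have [|t [t0 Gt le lt]] := psd_drop_rank _ _ _ _ G0 G1 _ G1_neq0; first by rewrite GE.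
pose l' f := l f - t * l1 f.
have G'E : gram l' = gram l - t *: gram l1 by apply: gram_subZ.
have l'S : in_SigmaX_dual I l'.
  apply/SigmaX_dualP; split; first exact: S2dual_subZ; last by rewrite G'E.
  by move=> f fI f2; rewrite /l' lI // l1I // mulr0 subr0.
have [||l'' [ext le'']] := IH l' _ l'S.
- by rewrite G'E; apply: leq_trans lt _.
(* If [l'] vanished, [l1] would be the multiple [t^-1] of [l]. *)
- apply: contrapT => H; apply: l1_nmul; exists t^-1; first by rewrite invr_ge0 ltW.
  move=> f; have t_neq0 : t != 0 by rewrite gt_eqF.
  apply: (mulfI t_neq0); rewrite mulVKf //.
  apply/esym/eqP; rewrite -subr_eq0; apply/negPn/negP => l'f.
  by apply: H; exists f.
- by exists l''; split=> //; apply: submx_trans le'' _; rewrite G'E.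
Qed.

(** The degree-2 projection is built in because [in_S2dual] requires a functional to factor through
    it. *)
Definition point_eval {R : realType} {n : nat} (z : 'rV[R]_n.+1) (f : {mpoly R[n.+1]}) : R :=
  (pihomog mdeg 2 f).@[z 0].

Lemma point_eval_S2dual (R : realType) (n : nat) (z : 'rV[R]_n.+1) :
  in_S2dual (point_eval z).
Proof.
split=> [a f g|f]; last by rewrite /point_eval pihomog_id.
by rewrite /point_eval linearP /= mevalD mevalZ.
Qed.

Lemma point_eval_gram (R : realType) (n : nat) (z : 'rV[R]_n.+1) :
  gram (point_eval z) = z^T *m z.
Proof.
apply/matrixP => i j; rewrite !mxE big_ord1 mxE /point_eval -mpolyXD pihomogX.
by rewrite /= mdegD !mdeg1 mpolyXD mevalM !mevalXU.
Qed.

(** If the diagonal vanished, every basis vector would be isotropic and [G] zero. All rows are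
    multiples of the nonzero row [i]; keeping the factor [G i i] on the right avoids a square
    root. *)
Lemma psd_rank1 (F : realFieldType) (d : nat) (G : 'M[F]_d) :
  psd G -> \rank G = 1 ->
  exists i, G i i != 0 /\ (row i G)^T *m row i G = G i i *: G.
Proof.
move=> G0 rkG; have [GT _] := G0.
have [i Gi] : exists i, G i i != 0.
  apply: contrapT => H; have : G = 0.
    apply/row_matrixP => i; rewrite row0 rowE; apply: psd_isotropic => //.
    rewrite /bil -rowE trmx_delta -colE !mxE; apply/eqP/negPn/negP => Gi.
    by apply: H; exists i.
  by move=> E; move: rkG; rewrite E mxrank0.
exists i; split=> //.
have z0 : row i G != 0 by apply: contraNneq Gi => /rowP/(_ i); rewrite !mxE => ->.
have Gz : (G <= row i G)%MS.
  have := mxrank_leqif_sup (row_sub i G); rewrite rkG rank_rV z0.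
  by move/leqif_refl.
apply/matrixP => k j; rewrite !mxE big_ord1 !mxE.
have /sub_rVP[c /rowP cE] : (row k G <= row i G)%MS by apply: submx_trans Gz; exact: row_sub.
have Gki a : G k a = c * G i a by have := cE a; rewrite !mxE.
have -> : G i k = G k i by rewrite -[in LHS]GT mxE.
by rewrite !Gki; ring.
Qed.

Lemma rank1_point_eval (R : realType) (n : nat) (I : pred {mpoly R[n.+1]}) l :
  in_SigmaX_dual I l -> form_rank l = 1 ->
  exists z c, [/\ z != 0, (z <= gram l)%MS & forall f, point_eval z f = c * l f].
Proof.
move=> /SigmaX_dualP[ldual _ G0] rk.
have [i [Gi GE]] := psd_rank1 _ _ _ G0 rk.
exists (row i (gram l)), (gram l i i); split; last 2 first.
- exact: row_sub.
- move=> f; apply/eqP; rewrite -subr_eq0; apply/eqP.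
  apply: (S2dual_eq0 _ _ (fun f => point_eval _ f - gram l i i * l f)).
    exact/S2dual_subZ/ldual/point_eval_S2dual.
  by rewrite gram_subZ point_eval_gram GE subrr.
- by apply: contraNneq Gi => /rowP/(_ i); rewrite mxE [RHS]mxE => ->.
Qed.

(** * The functional of a circuit and the choice of its parameter *)

Lemma evalC_real (R : realType) (n : nat) (f : {mpoly R[n.+1]}) (z : 'I_n.+1 -> R) :
  evalC f (fun i => real_complex R (z i)) = real_complex R f.@[z].
Proof.
rewrite /evalC /meval /mmap rmorph_sum; apply: eq_bigr => m _.
rewrite rmorphM /mmap1 rmorph_prod; congr (_ * _); apply: eq_bigr => i _.
by rewrite rmorphXn.
Qed.

(** In the coordinates given by [Q] the form is a positive diagonal matrix deflated along [h]. Its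
    image is therefore orthogonal to [h], which is the last conclusion. *)
Lemma circuit_functional (R : realType) (n m : nat) (Q : 'M[R]_(m, n.+1))
    (u : 'rV[R]_m) (t : R) :
  row_free Q -> (forall i, u 0 i != 0) -> (1 < m)%N -> 0 < t ->
  exists l, [/\ in_S2dual l /\
      (forall f : {mpoly R[n.+1]}, f \is 2.-homog -> (forall i, f.@[row i Q 0] = 0) ->
         f.@[(u *m Q) 0] = 0 -> l f = 0),
    psd (gram l), gram l != 0, (\rank (gram l) < m)%N
    & forall z : 'rV_n.+1, (z <= gram l)%MS ->
        exists2 w, z = w *m Q & \sum_i w 0 i * (u 0 i * t ^+ i) = 0].
Proof.
move=> Qfree u0 m1 t0; have tX i : 0 < t ^+ i by rewrite exprn_gt0.
have tX_neq0 i : t ^+ i != 0 by rewrite gt_eqF.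
pose D : 'M[R]_m := diag_mx (\row_i (t ^+ i)^-1).
(* Chosen so that [h *m D = u]: the deflation then subtracts a multiple of the square of evaluation
   at [u *m Q]. *)
pose h : 'rV[R]_m := \row_i (u 0 i * t ^+ i).
have hD : h *m D = u.
  by apply/rowP => i; rewrite mul_mx_diag !mxE mulfK // gt_eqF.
have bilD x : bil D x x = \sum_i x 0 i ^+ 2 / t ^+ i.
  rewrite /bil mul_mx_diag mxE; apply: eq_bigr => i _; rewrite !mxE; ring.
have D0 : psd D.
  split; first exact: tr_diag_mx.
  move=> x; rewrite bilD sumr_ge0 // => i _.
  by rewrite divr_ge0 ?sqr_ge0 // ltW.
have hh : 0 < bil D h h.
  rewrite bilD (bigD1 (Ordinal (ltnW m1))) //=.
  apply: ltr_wpDr; last by rewrite divr_gt0 // exprn_even_gt0 //= mxE mulf_neq0.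
  by rewrite sumr_ge0 // => i _; rewrite divr_ge0 ?sqr_ge0 // ltW.
have [] := psd_deflate _ _ D h D0 hh.
set b := (bil D h h)^-1; rewrite hD; set N := D - _ => N0 hN rkN.
have [NT Nge0] := N0.
pose l f := \sum_(i < m) (t ^+ i)^-1 * point_eval (row i Q) f - b * point_eval (u *m Q) f.
have gramE : gram l = Q^T *m N *m Q.
  rewrite /N mulmxBr mulmxBl -scalemxAr -scalemxAl !mulmxA -trmx_mul -(mulmxA (u *m Q)^T).
  rewrite -point_eval_gram; apply/matrixP => i j; rewrite !mxE; congr (_ - _).
  apply: eq_bigr => k _; rewrite mul_mx_diag !mxE.
  have /matrixP/(_ i j) := point_eval_gram _ _ (row k Q).
  by rewrite !mxE big_ord1 !mxE => ->; ring.
have NQ_inj : (Q^T *m N *m Q == 0) -> N = 0.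
  move=> /eqP E; apply: (row_free_inj Qfree); rewrite mul0mx.
  have /(row_free_inj Qfree) E' : Q^T *m N *m Q = 0 *m Q by rewrite E mul0mx.
  by rewrite -[N *m Q]trmxK trmx_mul NT E' trmx0.
have N_neq0 : N != 0.
  (* [D] has rank [m > 1] and deflation costs at most one, so [N] keeps positive rank. *)
  apply: contraTneq rkN => ->; rewrite mxrank0 -ltnNge.
  suff -> : \rank D = m by [].
  apply/eqP; rewrite -/(row_free D) -kermx_eq0; apply/rowV0P => x /sub_kermxP.
  rewrite mul_mx_diag => /rowP xD; apply/rowP => i; have := xD i.
  by rewrite !mxE => /eqP; rewrite mulf_eq0 invr_eq0 (gt_eqF (tX i)) orbF => /eqP.
exists l; split.
- split; last first.
    move=> f f2 fQ fu; rewrite /l /point_eval pihomog_dE // fu mulr0 subr0.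
    by rewrite big1 // => i _; rewrite fQ mulr0.
  have sumdual : in_S2dual (fun f => \sum_(i < m) (t ^+ i)^-1 * point_eval (row i Q) f).
    split=> [a f g|f]; last first.
      by apply: eq_bigr => i _; rewrite (proj2 (point_eval_S2dual _ _ _)).
    rewrite mulr_sumr -big_split; apply: eq_bigr => i _ /=.
    rewrite (proj1 (point_eval_S2dual _ _ _)); ring.
  exact/S2dual_subZ/point_eval_S2dual.
- rewrite gramE; split; first by rewrite !trmx_mul trmxK NT mulmxA.
  move=> x; have := Nge0 (x *m Q^T).
  by rewrite /bil trmx_mul trmxK !mulmxA.
- by rewrite gramE; apply: contraNneq N_neq0 => /eqP/NQ_inj ->.
- rewrite gramE; apply: leq_ltn_trans (mxrankM_maxl _ _) _.
  apply: leq_ltn_trans (mxrankM_maxr _ _) _.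
  rewrite ltn_neqAle rank_leq_row andbT -/(row_free N); apply/negP => Nfree.
  have h0 : h = 0 by apply: (row_free_inj Nfree); rewrite hN mul0mx.
  by move: hh; rewrite h0 /bil !mul0mx mxE ltxx.
- move=> z; rewrite gramE => /submxP[y ->]; exists (y *m Q^T *m N).
    by rewrite !mulmxA.
  have : (y *m Q^T *m N) *m h^T = 0.
    by rewrite -mulmxA -[N]NT -trmx_mul hN trmx0 mulmx0.
  move=> /rowP/(_ 0); rewrite mxE [RHS]mxE => E; rewrite -[RHS]E.
  by apply: eq_bigr => i _; rewrite [h^T _ _]mxE [h _ _]mxE.
Qed.

(** After embedding in the complex numbers, both sides equal [c * c' * w i * w j]. Cross products
    avoid dividing by the complex scalars. *)
Lemma real_multiples (R : realType) (T : Type) (x y : T -> R) (w : T -> R[i]) c c' :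
  (forall j, real_complex R (x j) = c * w j) ->
  (forall j, real_complex R (y j) = c' * w j) ->
  forall i j, x j * y i = x i * y j.
Proof.
move=> xE yE i j; apply: (fmorph_inj (real_complex R)).
rewrite !rmorphM /= !xE !yE; ring.
Qed.

(** As [Q] has independent rows, the real [x] lying over one complex point [w a] are multiples of a
    single [y a]. Each point thus gives one condition on [t]. *)
Lemma generic_parameter (R : realType) (n m k : nat) (Q : 'M[R]_(k, n.+1))
    (u : 'rV[R]_k) (w : 'I_m -> 'I_n.+1 -> R[i]) :
  row_free Q -> (forall i, u 0 i != 0) -> (0 < k)%N ->
  exists2 t, 0 < t &
    forall (x : 'rV[R]_k) a c, x != 0 ->
      (forall j, real_complex R ((x *m Q) 0 j) = c * w a j) ->
      \sum_i x 0 i * (u 0 i * t ^+ i) != 0.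
Proof.
move=> Qfree u0 k0.
have /fin_all_exists[y yP] a : exists y : 'rV[R]_k, y != 0 /\
    forall x c, x != 0 -> (forall j, real_complex R ((x *m Q) 0 j) = c * w a j) ->
      exists2 d, d != 0 & x = d *: y.
  have [[y [y0 [c yc]]]|noy] := pselect (exists y : 'rV[R]_k, y != 0 /\
     exists c, forall j, real_complex R ((y *m Q) 0 j) = c * w a j); last first.
    (* No nonzero [x] lies over this point, so any nonzero vector will do. *)
    exists u; split; first by apply/rV0Pn; exists (Ordinal k0).
    by move=> x c x0 xc; case: noy; exists x; split=> //; exists c.
  exists y; split=> // x c' x0 xc.
  have /rV0Pn[j yj] : y *m Q != 0.
    apply: contraNneq y0 => yQ; apply/eqP/(row_free_inj Qfree).
    by rewrite yQ mul0mx.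
  pose d := (x *m Q) 0 j / (y *m Q) 0 j.
  have xE : x = d *: y.
    apply: (row_free_inj Qfree); apply/rowP => i; rewrite -scalemxAl [RHS]mxE.
    apply: (mulIf yj); rewrite (real_multiples _ _ _ _ _ _ _ xc yc j i).
    by rewrite /d mulrAC divfK.
  exists d => //; apply: contraNneq x0 => d0.
  by rewrite xE d0 scale0r.
have [a|t t0 tP] := moment_curve_avoids _ _ _ (fun a => \row_i (y a 0 i * u 0 i)).
  have [/rV0Pn[i yi] _] := yP a; apply/rV0Pn; exists i.
  by rewrite mxE mulf_neq0.
exists t => // x a c x0 xc; have [_ /(_ x c x0 xc)[d d0 ->]] := yP a.
suff -> : \sum_i (d *: y a) 0 i * (u 0 i * t ^+ i) =
    d * \sum_i (\row_i (y a 0 i * u 0 i)) 0 i * t ^+ i by rewrite mulf_neq0.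
rewrite mulr_sumr; apply: eq_bigr => i _; rewrite !mxE; ring.
Qed.

(* X ⊆ P^n is given by its (saturated, radical, homogeneous) ideal I = I(X) in
   S = R[x_0..x_n]; W is the projectivisation of the row space of A. *)
Theorem theorem4p1 (R : realType) (n p : nat) (I : pred {mpoly R[n.+1]})
    (A : 'M[R]_(p.+1, n.+1)) (q : 'I_p.+2 -> 'I_n.+1 -> R) :
  is_homog_ideal I -> is_radical I -> is_saturated I ->
  nondegenerate_var I -> settheor_quadrics I ->
  \rank A = p.+1 ->
  zero_dimensional (sum_ideal I A) ->
  (forall i, real_point_of (sum_ideal I A) (q i)) ->
  (forall i j, i != j -> ~ proportionalR (q i) (q j)) ->
  (forall i, reduced_at (sum_ideal I A) (q i)) ->
  hankel_index_le I p.
Proof.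
move=> [I0 _ _ _] _ _ _ Iquad rkA [_ [m [w wP]]] qJ qprop _.
pose qm : 'M[R]_(p.+2, n.+1) := \matrix_(i, j) q i j.
have qI i f : f \in I -> f.@[q i] = 0.
  move=> fI; apply: (proj2 (qJ i)); exists f; split => //.
  by exists [::]; split => //; rewrite big_nil addr0.
(* Columns of [cokermx A] are linear forms vanishing on W; they belong to the ideal of Gamma and
   hence vanish at each [q i]. *)
have qA : (qm <= A)%MS.
  rewrite submxE; apply/eqP; move: (cokermx A) (mulmx_coker A) => B AB.
  apply/matrixP => i c; rewrite [RHS]mxE.
  pose y := (col c B)^T.
  have yE x : (linform y).@[x] = \sum_j x j * B j c.
    by rewrite linform_eval; apply: eq_bigr => j _; rewrite !mxE mulrC.
  have [_ /(_ (linform y)) yq] := qJ i.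
  suff /yq : sum_ideal I A (linform y).
    by rewrite yE mxE => E; rewrite -[RHS]E; apply: eq_bigr => j _; rewrite [qm _ _]mxE.
  exists 0; split=> //; exists [:: (1, linform y)]; split; last first.
    by rewrite big_seq1 mul1r add0r.
  move=> x; rewrite inE => /eqP ->; split; first exact: linform_homog.
  move=> a; rewrite yE.
  by have /matrixP/(_ a c) := AB; rewrite mxE [RHS]mxE.
(* There are [p.+2] rows in a space of dimension [p.+1]. *)
have [v v0 vq] : exists2 v : 'rV_p.+2, v != 0 & v *m qm = 0.
  have : kermx qm != 0.
    rewrite kermx_eq0 /row_free neq_ltn; apply/orP; left.
    by rewrite ltnS -[leqRHS]rkA mxrankS.
  by case/rowV0Pn => v /sub_kermxP vq v0; exists v.
have /rV0Pn[j0 vj0] := v0.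
have [k [f [u [kp uE Qfree u0]]]] :=
  (* The relation [v] solved for row [j0]. *)
  support_circuit _ _ _ (row' j0 qm) (- (v 0 j0)^-1 *: col' j0 v).
have {uE} uE : u *m rowsub f (row' j0 qm) = row j0 qm.
  rewrite uE -scalemxAl; apply/rowP => j; apply: (mulfI vj0).
  have /rowP/(_ j) := vq; rewrite !mxE (bigD1_ord j0) //= mxE.
  rewrite mulrA mulrN mulfV // mulN1r => /eqP; rewrite addr_eq0 => /eqP ->.
  by congr (- _); apply: eq_bigr => i _; rewrite !mxE.
set Q := rowsub _ _ in uE Qfree.
have QE i j : Q i j = q (lift j0 (f i)) j by rewrite !mxE.
have QA : (Q <= A)%MS.
  apply/row_subP => i; apply: submx_trans qA.
  have -> : row i Q = row (lift j0 (f i)) qm by apply/rowP => j; rewrite !mxE.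
  exact: row_sub.
have qE j : q j0 j = \sum_i u 0 i * q (lift j0 (f i)) j.
  have /rowP/(_ j) := uE; rewrite !mxE => <-.
  by apply: eq_bigr => i _; rewrite QE.
(* [k = 0] would make [q j0] zero, and [k = 1] would make it proportional to another [q i]. *)
have k1 : (1 < k)%N.
  move: qE; clear -qJ qprop; case: k f u => [|[|k]] // f u qE.
    by have [[j qj] _] := qJ j0; rewrite qE big_ord0 eqxx in qj.
  case: (qprop j0 (lift j0 (f 0))); first exact: neq_lift.
  by exists (u 0 0) => j; rewrite qE big_ord1.
have [t t0 tP] := generic_parameter _ _ _ _ Q u w Qfree u0 (ltnW k1).
have [l [[ldual lvan] lpsd l0 lrk lz]] := circuit_functional _ _ _ Q u t Qfree u0 k1 t0.
have lS : in_SigmaX_dual I l.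
  apply/SigmaX_dualP; split=> // g gI g2; apply: lvan => // [i|].
    by rewrite -(qI (lift j0 (f i)) g gI); apply: meval_eq => j; rewrite mxE QE.
  by rewrite uE -(qI j0 g gI); apply: meval_eq => j; rewrite !mxE.
have l_neq0 : exists g, l g != 0.
  apply: contrapT => H; move/eqP: l0; apply; apply/matrixP => i j.
  by rewrite !mxE; apply/eqP/negPn/negP => lij; apply: H; exists ('X_i * 'X_j).
have [l' [ext l'l]] := exists_extreme_ray _ _ _ _ lS l_neq0.
exists l'; split=> //; have [l'S l'_neq0 _] := ext.
(* The rank of [l] is less than [k], which is at most [p.+1]. *)
have rk' : (form_rank l' <= p)%N.
  by rewrite -ltnS; apply: leq_trans kp; apply: leq_ltn_trans (mxrankS l'l) lrk.
rewrite rk' andbT ltn_neqAle lt0n mxrank_eq0 gram_neq0 ?andbT; last 2 first.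
- by have /SigmaX_dualP[] := l'S.
- by [].
apply/eqP => /esym rk1.
have [z [c [z0 zl' zc]]] := rank1_point_eval _ _ _ _ l'S rk1.
have [x zE xt] := lz z (submx_trans zl' l'l).
have /SigmaX_dualP[_ l'I _] := l'S.
pose zC j := real_complex R (z 0 j).
have zC0 : nonzeroC zC.
  by have /rV0Pn[j zj] := z0; exists j; rewrite fmorph_eq0.
(* Up to a scalar [l'] is evaluation at [z] and kills the quadrics of [I]; since these cut out X,
   [z] lies on X. *)
have zI g : g \in I -> evalC g zC = 0.
  apply: Iquad => // {}g gI g2; rewrite evalC_real.
  have := zc g; rewrite /point_eval pihomog_dE // l'I // mulr0 => ->.
  exact: rmorph0.
have zA : (z <= A)%MS by rewrite zE; apply: submx_trans QA; apply: submxMl.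
(* As [z] also lies on W, it is a point of Gamma and occurs in the list [w]. *)
have [|a [d zd]] := wP zC zC0.
  move=> _ [g [gI [s [sA ->]]]].
  have := zI g gI; rewrite !evalC_real => /eqP; rewrite fmorph_eq0 => /eqP gz.
  apply/eqP; rewrite fmorph_eq0 mevalD gz add0r raddf_sum big_seq.
  apply/eqP/big1 => y ys /=; rewrite mevalM.
  have [/homog1_linform[b ->] bA] := sA y ys.
  have /submxP[e ->] := zA.
  suff -> : (linform b).@[(e *m A) 0] = 0 by rewrite mulr0.
  have bA0 : A *m b^T = 0.
    apply/colP => i; rewrite [RHS]mxE -[RHS](bA i) linform_eval mxE.
    by apply: eq_bigr => j _; rewrite mxE mulrC.
  have /rowP/(_ 0) : e *m A *m b^T = 0 by rewrite -mulmxA bA0 mulmx0.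
  rewrite mxE [RHS]mxE linform_eval => E; rewrite -[RHS]E.
  by apply: eq_bigr => j _; rewrite [b^T _ _]mxE mulrC.
have x0 : x != 0 by apply: contraNneq z0 => x0; rewrite zE x0 mul0mx.
have xd j : real_complex R ((x *m Q) 0 j) = d * w a j by rewrite -zE; apply: zd.
by have := tP x a d x0 xd; rewrite xt eqxx.
Qed.
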